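(* Let $d,n\in\mathbb{N}$, $\alpha>1/2$, let $\boldsymbol{\gamma}=(\gamma_1,\gamma_2,\ldots)$ satisfy $1\ge\gamma_1\ge\gamma_2\ge\cdots>0$, and let $\boldsymbol{z}\in\{0,1,\ldots,n-1\}^d$. The squared worst-case integration error of the tent-transformed lattice rule $Q_n(\cdot\circ\psi;\boldsymbol{z})$ in the cosine space $C_{d,\alpha,\boldsymbol{\gamma}}$ is $$e^{\mathrm{wor}}(Q_n(\cdot\circ\psi;\boldsymbol{z});C_{d,\alpha,\boldsymbol{\gamma}})^2=\sum_{\boldsymbol{0}\ne\boldsymbol{k}\in\Lambda(\boldsymbol{z},n)^\perp}\frac{1}{r_{\alpha,\boldsymbol{\gamma}}(\boldsymbol{k})}\left(\frac{1}{2^d}\sum_{\boldsymbol{\sigma}\in\{\pm1\}^d}\mathbf{1}_{\boldsymbol{\sigma}(\boldsymbol{k})\in\Lambda(\boldsymbol{z},n)^\perp}\right).$$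
   Context: Notation. $\mathbb{Z}_+=\{0,1,2,\ldots\}$. For $\boldsymbol{k}\in\mathbb{Z}^d$, $|\boldsymbol{k}|_0$ is the number of non-zero components. The half-period cosine basis of $L_2([0,1]^d)$ is $\phi_{\boldsymbol{k}}(\boldsymbol{x})=(\sqrt2)^{|\boldsymbol{k}|_0}\prod_{j=1}^d\cos(\pi k_jx_j)$, $\boldsymbol{k}\in\mathbb{Z}_+^d$, and $\hat f(\boldsymbol{k})=\int_{[0,1]^d}f(\boldsymbol{x})\phi_{\boldsymbol{k}}(\boldsymbol{x})\,d\boldsymbol{x}$. For $\boldsymbol{k}\in\mathbb{Z}^d$, $r_{\alpha,\boldsymbol{\gamma}}(\boldsymbol{k})=\prod_{j=1}^d r_{\alpha,\gamma_j}(k_j)$, where $r_{\alpha,\gamma_j}(0)=1$ and $r_{\alpha,\gamma_j}(k)=|k|^{2\alpha}/\gamma_j$ for $k\ne0$. Cosine space: $C_{d,\alpha,\boldsymbol{\gamma}}$ is the space of complex-valued $f\in L_2([0,1]^d)$ with $\|f\|_{C_{d,\alpha,\boldsymbol{\gamma}}}^2=\sum_{\boldsymbol{k}\in\mathbb{Z}_+^d}|\hat f(\boldsymbol{k})|^2r_{\alpha,\boldsymbol{\gamma}}(\boldsymbol{k})<\infty$. For $\alpha>1/2$ it is a reproducing kernel Hilbert space, each $f$ being identified with its continuous representative $\sum_{\boldsymbol{k}\in\mathbb{Z}_+^d}\hat f(\boldsymbol{k})\phi_{\boldsymbol{k}}$. Tent transformation: $\psi(x)=1-|2x-1|$ for $x\in[0,1]$,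 applied componentwise to vectors. The tent-transformed lattice rule is $Q_n(f\circ\psi;\boldsymbol{z})=\frac1n\sum_{i=1}^n f\big(\psi(\tfrac{i\boldsymbol{z}}{n}\bmod 1)\big)$, with $\bmod\ 1$ taken componentwise. Dual lattice: $\Lambda(\boldsymbol{z},n)^\perp=\{\boldsymbol{h}\in\mathbb{Z}^d:\boldsymbol{h}\cdot\boldsymbol{z}\equiv0\pmod n\}$. For $\boldsymbol{\sigma}\in\{\pm1\}^d$, $\boldsymbol{\sigma}(\boldsymbol{k})=(\sigma_1k_1,\ldots,\sigma_dk_d)$. $\mathbf{1}_P$ equals $1$ if $P$ holds and $0$ otherwise. The worst-case integration error of a cubature rule $Q$ in a normed function space $H$ is $e^{\mathrm{wor}}(Q;H)=\sup_{f\in H,\ \|f\|_H\le1}\big|\int_{[0,1]^d}f(\boldsymbol{x})\,d\boldsymbol{x}-Q(f)\big|$. *)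

(* Defs.v *)
From HB Require Import structures.
From mathcomp Require Import all_boot all_order all_algebra.
From mathcomp Require Import finmap.
From mathcomp Require Import complex.
From mathcomp Require Import all_classical all_reals all_analysis.
From mathcomp.analysis Require Import showcase.summability.

Set Implicit Arguments.
Unset Strict Implicit.
Unset Printing Implicit Defensive.

Import Order.TTheory GRing.Theory Num.Theory.
Import numFieldNormedType.Exports.

Local Open Scope classical_set_scope.
Local Open Scope ring_scope.
Local Open Scope complex_scope.

(* Points of R^d are d-tuples: [d.-tuple T] carries the product sigma-algebra. *)
Notation point R d := (d.-tuple (measurableTypeR R)).

(* The library has no d-dimensional Lebesgue measure.  It is built by recursion
   on d, as the image of the product of the one-dimensional measure and the
   (d-1)-dimensional one under (a, t) |-> a :: t. *)
Section lebesgue_cons.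
Context (R : realType) (d : nat).
Variable mu : {sigma_finite_measure set (point R d) -> \bar R}.

Definition cons_point (p : measurableTypeR R * point R d) : point R d.+1 :=
  [the d.+1.-tuple (measurableTypeR R) of p.1 :: p.2].

Lemma measurable_cons_point : measurable_fun setT cons_point.
Proof. exact: measurable_cons. Qed.

Definition lebesgue_cons (A : set (point R d.+1)) : \bar R :=
  pushforward (@lebesgue_measure R \x mu)%E cons_point A.

Let lebesgue_cons0 : lebesgue_cons set0 = 0%E.
Proof. by rewrite /lebesgue_cons /pushforward preimage_set0 measure0. Qed.

Let lebesgue_cons_ge0 A : (0 <= lebesgue_cons A)%E.
Proof. by apply: integral_ge0 => x _; exact: measure_ge0. Qed.

Let lebesgue_cons_sigma_additive : semi_sigma_additive lebesgue_cons.
Proof.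
move=> F mF tF mUF; rewrite /lebesgue_cons /pushforward preimage_bigcup.
have mP A : measurable A -> measurable (cons_point @^-1` A).
  by move=> mA; rewrite -[X in measurable X]setTI; exact: measurable_cons_point.
apply: measure_semi_sigma_additive.
- by move=> n; exact: mP.
- apply/trivIsetP => /= i j _ _ ij; rewrite -preimage_setI.
  by move/trivIsetP : tF => /(_ _ _ _ _ ij) ->//; rewrite preimage_set0.
- by rewrite -preimage_bigcup; exact: mP.
Qed.

HB.instance Definition _ := isMeasure.Build _ _ _ lebesgue_cons
  lebesgue_cons0 lebesgue_cons_ge0 lebesgue_cons_sigma_additive.

Let lebesgue_cons_sigma_finite : sigma_finite setT lebesgue_cons.
Proof.
have /sigma_finiteP[F [TF ndF Foo]] := sigma_finiteT (@lebesgue_measure R).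
have /sigma_finiteP[G [TG ndG Goo]] := sigma_finiteT mu.
pose un (x : point R d.+1) : measurableTypeR R * point R d :=
  (tnth x ord0, [tuple of behead x]).
have unK : cancel cons_point un.
  by case=> a t; congr pair; apply/val_inj.
have mun : measurable_fun setT un.
  apply/measurable_fun_pairP; split.
    exact: measurable_tnth.
  exact: measurable_behead.
exists (fun n => un @^-1` (F n `*` G n)).
  rewrite -preimage_bigcup -(preimage_setT un); congr (_ @^-1` _).
  rewrite -setXTT TF TG predeqE => -[x y]; split.
    move=> [/= [n _ Fnx] [k _ Gky]]; exists (maxn n k) => //; split.
    - by move: x Fnx; exact/subsetPset/ndF/leq_maxl.
    - by move: y Gky; exact/subsetPset/ndG/leq_maxr.
  by move=> [n _ []/= ? ?]; split; exists n.
move=> k; have [? ?] := Foo k; have [? ?] := Goo k.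
have mFG : measurable (F k `*` G k) by exact: measurableX.
split; first by rewrite -[X in measurable X]setTI; exact: mun.
rewrite /lebesgue_cons /pushforward.
rewrite (_ : cons_point @^-1` (un @^-1` _) = F k `*` G k); last first.
  by apply/seteqP; split => p; rewrite /preimage /mkset unK.
by rewrite product_measure1E// lte_mul_pinfty// ge0_fin_numE.
Qed.

HB.instance Definition _ := Measure_isSigmaFinite.Build _ _ _ lebesgue_cons
  lebesgue_cons_sigma_finite.

End lebesgue_cons.

Fixpoint lebesgue_point (R : realType) (d : nat) :
    {sigma_finite_measure set (point R d) -> \bar R} :=
  match d with
  | 0 => \d_([tuple] : point R 0)
  | d'.+1 => lebesgue_cons (lebesgue_point R d')
  end.

Lemma measurable_box (R : realType) (d : nat)
    (A : 'I_d -> set (measurableTypeR R)) :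
  (forall j, measurable (A j)) ->
  measurable [set x : point R d | forall j, A j (tnth x j)].
Proof.
move=> mA.
rewrite (_ : [set x | _] = \big[setI/setT]_(j < d)
    ((fun x => tnth x j) @^-1` A j)).
  apply: bigsetI_measurable => j _.
  by rewrite -[X in measurable X]setTI; exact: measurable_tnth.
apply/seteqP; split => t /=.
  by move=> tA; rewrite -bigcap_seq => j _; exact: tA.
by rewrite -bigcap_seq => tA j; apply: tA; rewrite /= mem_index_enum.
Qed.

Lemma lebesgue_point_box (R : realType) (d : nat)
    (A : 'I_d -> set (measurableTypeR R)) :
  (forall j, measurable (A j)) ->
  lebesgue_point R d [set x | forall j, A j (tnth x j)] =
  (\prod_(j < d) lebesgue_measure (A j))%E.
Proof.
elim: d A => [|d IH] A mA.
  rewrite big_ord0 /= diracE mem_set//= => -[]//.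
have mB := @measurable_box R d (fun j => A (lift ord0 j)) (fun j => mA _).
rewrite big_ord_recl -IH//= -product_measure1E//.
rewrite /lebesgue_cons /pushforward; congr (_ _).
apply/seteqP; split => -[a t] /=.
  move=> H; split; first exact: (H ord0).
  by move=> j; have := H (lift ord0 j); rewrite tnthS.
move=> [Aa At] j; case: (unliftP ord0 j) => [i ->|->]; first by rewrite tnthS.
by rewrite tnth0.
Qed.

Section cosine_space.
Context (R : realType) (d : nat).
Implicit Types (f : point R d -> R[i]) (x : point R d).

Definition cube : set (point R d) := [set x | forall j, 0 <= (tnth x j : R) <= 1].

Lemma cubeE : cube = [set x | forall j, `[0, 1]%classic (tnth x j : R)].
Proof. by apply/seteqP; split=> x /= xP j; have := xP j; rewrite in_itv. Qed.

Lemma measurable_cube : measurable cube.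
Proof.
rewrite cubeE; apply: (@measurable_box R d (fun=> `[0, 1]%classic)) => j.
exact: measurable_itv.
Qed.

Lemma lebesgue_point_cube : lebesgue_point R d cube = 1%E.
Proof.
rewrite cubeE (@lebesgue_point_box R d (fun=> `[0, 1]%classic)); last first.
  by move=> j; exact: measurable_itv.
by rewrite big1// => j _; rewrite lebesgue_measure_itv/= lte_fin ltr01 oppr0 adde0.
Qed.

Definition cube_integral f : R[i] :=
  (\int[lebesgue_point R d]_(x in cube) complex.Re (f x)) +i*
  (\int[lebesgue_point R d]_(x in cube) complex.Im (f x)).

Definition square_integrable f : Prop :=
  [/\ measurable_fun cube (fun x => complex.Re (f x) : measurableTypeR R),
      measurable_fun cube (fun x => complex.Im (f x) : measurableTypeR R) &
      (\int[lebesgue_point R d]_(x in cube) (Normc.normc (f x) ^+ 2)%:E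
        < +oo)%E].

Definition cosine_basis (k : {ffun 'I_d -> nat}) x : R :=
  Num.sqrt 2 ^+ #|[set j | k j != 0%N]%SET| *
  \prod_(j < d) cos (pi * (k j)%:R * (tnth x j : R)).

Definition cosine_coef f (k : {ffun 'I_d -> nat}) : R[i] :=
  cube_integral (fun x => f x * (cosine_basis k x)%:C).

Definition weight1 (alpha gamma_j : R) (k : int) : R :=
  if k == 0 then 1 else (`|k|%:~R `^ (2 * alpha)) / gamma_j.

(* The informal gamma_1, gamma_2, ... are gamma 0, gamma 1, ... *)
Definition weight (alpha : R) (gamma : nat -> R) (k : {ffun 'I_d -> int}) : R :=
  \prod_(j < d) weight1 alpha (gamma j) (k j).

Definition cosine_sqnorm (alpha : R) (gamma : nat -> R) f : \bar R :=
  \esum_(k in [set: {ffun 'I_d -> nat}])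
    (Normc.normc (cosine_coef f k) ^+ 2
      * weight alpha gamma [ffun j => (k j)%:Z])%:E.

Definition cosine_norm (alpha : R) (gamma : nat -> R) f : \bar R :=
  sqrte (cosine_sqnorm alpha gamma f).

(* f agrees at every point of the cube (not just almost everywhere) with its
   cosine series; the series is summed unconditionally, i.e. along the net of
   finite subsets of the index set. *)
Definition is_cosine_representative f : Prop :=
  forall x, cube x ->
    ((\sum_(k <- A) cosine_coef f k * (cosine_basis k x)%:C : R[i]^o)
      @[A --> @totally {ffun 'I_d -> nat}] --> (f x : R[i]^o)).

(* Elements are functions rather than almost-everywhere classes: each class is
   represented by its continuous representative, so that point evaluation in
   the cube is meaningful.  Values outside the cube are irrelevant. *)
Definition cosine_space (alpha : R) (gamma : nat -> R) :
    set (point R d -> R[i]) :=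
  [set f | [/\ square_integrable f,
               (cosine_sqnorm alpha gamma f < +oo)%E &
               is_cosine_representative f]].

Definition worst_case_error (H : set (point R d -> R[i]))
    (normH : (point R d -> R[i]) -> \bar R)
    (Q : (point R d -> R[i]) -> R[i]) : \bar R :=
  ereal_sup [set (Normc.normc (cube_integral f - Q f))%:E
            | f in [set f | H f /\ (normH f <= 1)%E]].

End cosine_space.

Definition frac_part (R : realType) (x : R) : R := x - (Num.floor x)%:~R.

Definition tent (R : realType) (x : R) : R := 1 - `|2 * x - 1|.

Definition tent_lattice_point (R : realType) (d n : nat)
    (z : {ffun 'I_d -> 'I_n}) (i : nat) : point R d :=
  [tuple tent (frac_part (i%:R * (z j)%:R / n%:R)) | j < d].

Definition tent_lattice_rule (R : realType) (d n : nat)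
    (z : {ffun 'I_d -> 'I_n}) (f : point R d -> R[i]) : R[i] :=
  n%:R^-1 * \sum_(1 <= i < n.+1) f (tent_lattice_point R z i).

Definition dual_lattice (d n : nat) (z : {ffun 'I_d -> 'I_n}) :
    pred {ffun 'I_d -> int} :=
  fun h => (n%:Z %| \sum_(j < d) h j * (z j)%:Z)%Z.

(* Sign vectors in {1, -1}^d are encoded as boolean vectors, true being -1. *)
Definition flip_signs (d : nat) (sigma : {ffun 'I_d -> bool})
    (k : {ffun 'I_d -> int}) : {ffun 'I_d -> int} :=
  [ffun j => (-1) ^+ sigma j * k j].

(* Main.v *)
(** Every f in the space satisfies
      I(f) - Q(f) = - sum_{k <> 0} f^(k) b_k,   where b_k = Q(phi_k)
    and b_0 = 1, so by Cauchy-Schwarz the squared worst-case error is at most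
    sum_{k <> 0} b_k^2 / r(k); the normalised cosine polynomials with
    coefficients b_k / r(k) on finite sets of frequencies show that this bound
    is attained in the limit.  Since cos(pi k tent(x)) = cos(2 pi k x),
    expanding the product of cosines and summing over the lattice points gives
      b_k = sqrt(2)^{|k|_0} 2^{-d} sum_sigma 1[sigma(k) in dual lattice],
    and the sum over N^d is unfolded into one over Z^d by symmetry under sign
    changes. *)

Require Import Defs.
From HB Require Import structures.
From mathcomp Require Import all_boot all_order all_algebra.
From mathcomp Require Import finmap.
From mathcomp Require Import complex.
From mathcomp Require Import all_classical all_reals all_analysis.
From mathcomp Require Import measurable_realfun ring lra.
From mathcomp.analysis Require Import showcase.summability.

Import Order.TTheory GRing.Theory Num.Theory.
Import numFieldNormedType.Exports.

Local Open Scope classical_set_scope.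
Local Open Scope ring_scope.
Local Open Scope complex_scope.

(** * Integrals of tensor products over [R^d] *)

(** Tonelli: the iterated integral of [|f| |g|] splits into a product of two finite integrals. *)
Lemma integrable_tensor d1 d2 (T1 : measurableType d1) (T2 : measurableType d2)
    (R : realType) (m1 : {sigma_finite_measure set T1 -> \bar R})
    (m2 : {sigma_finite_measure set T2 -> \bar R}) (f : T1 -> R) (g : T2 -> R) :
  m1.-integrable setT (EFin \o f) -> m2.-integrable setT (EFin \o g) ->
  (m1 \x m2)%E.-integrable setT (fun p => (f p.1 * g p.2)%:E).
Proof.
move=> fi gi.
have mf : measurable_fun setT f by exact/measurable_EFinP/(measurable_int _ fi).
have mg : measurable_fun setT g by exact/measurable_EFinP/(measurable_int _ gi).
apply/integrable12ltyP.
  apply/measurable_EFinP; apply: measurable_funM.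
  - exact: measurableT_comp.
  - exact: measurableT_comp.
rewrite /=.
under eq_integral => x _.
  under eq_integral do rewrite normrM EFinM.
  rewrite ge0_integralZl//; last first.
    by apply/measurable_EFinP; exact: measurableT_comp.
  over.
have fin2 : (\int[m2]_y `|g y|%:E)%E \is a fin_num.
  by have /integrable_norm/integrable_fin_num := gi; exact.
rewrite -(fineK fin2) ge0_integralZr//.
- rewrite fineK// lte_mul_pinfty//.
  + by apply: integral_ge0.
  + by have /integrable_norm/integrable_fin_num := fi; exact.
  + by rewrite ltey_eq fin2.
- by apply/measurable_EFinP; exact: measurableT_comp.
- by rewrite fineK// integral_ge0.
Qed.

Lemma integral_tensor d1 d2 (T1 : measurableType d1) (T2 : measurableType d2)
    (R : realType) (m1 : {sigma_finite_measure set T1 -> \bar R})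
    (m2 : {sigma_finite_measure set T2 -> \bar R}) (f : T1 -> R) (g : T2 -> R) :
  m1.-integrable setT (EFin \o f) -> m2.-integrable setT (EFin \o g) ->
  (\int[m1 \x m2]_p (f p.1 * g p.2)%:E)%E =
  ((\int[m1]_x f x) * (\int[m2]_y g y))%:E.
Proof.
move=> fi gi.
have ff := integrable_fin_num measurableT fi.
have gf := integrable_fin_num measurableT gi.
rewrite -integral12_prod_meas1; last exact: integrable_tensor.
rewrite /fubini_F/=.
under eq_integral => x _.
  under eq_integral do rewrite EFinM.
  rewrite integralZl//.
  rewrite -(fineK gf).
  over.
by rewrite integralZr// EFinM /Rintegral !fineK.
Qed.

(** Induction on [d]: the measure is an image under [cons_point], so the integral pulls back to a
    product measure and the first coordinate splits off. Integrability and value are proved together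
    because Fubini in the inductive step needs the integrability in dimension [d]. *)
Lemma lebesgue_point_prod (R : realType) d (g : 'I_d -> R -> R) :
  (forall j, (@lebesgue_measure R).-integrable setT (EFin \o g j)) ->
  (lebesgue_point R d).-integrable setT
     (fun x : Defs.point R d => (\prod_(j < d) g j (tnth x j))%:E) /\
  (\int[lebesgue_point R d]_x (\prod_(j < d) g j (tnth x j))%:E)%E =
  (\prod_(j < d) \int[@lebesgue_measure R]_x g j x)%:E.
Proof.
elim: d g => [|d IH] g ig.
  have -> : (fun x : Defs.point R 0 => (\prod_(j < 0) g j (tnth x j))%:E) =
      cst 1%E.
    by apply/funext => x; rewrite big_ord0.
  rewrite big_ord0 integral_cst//= diracT mule1; split=> //.
  apply/integrableP; split => //.
  under eq_integral do rewrite /= normr1.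
  by rewrite integral_cst//= diracT mule1 ltry.
pose h (p : measurableTypeR R * Defs.point R d) :=
  g ord0 p.1 * \prod_(j < d) g (lift ord0 j) (tnth p.2 j).
pose F (x : Defs.point R d.+1) : \bar R := (\prod_(j < d.+1) g j (tnth x j))%:E.
have Fcons : F \o @cons_point R d = EFin \o h.
  apply/funext => -[a t]; rewrite /F /h/= big_ord_recl tnth0.
  by congr (_ * _)%:E; apply: eq_bigr => j _; rewrite tnthS.
have [iT eT] := IH _ (fun j => ig (lift ord0 j)).
pose prod := (@lebesgue_measure R \x lebesgue_point R d)%E.
have ih : prod.-integrable setT (EFin \o h).
  exact: (@integrable_tensor _ _ _ _ _ _ _ _
    (fun t : Defs.point R d => \prod_(j < d) g (lift ord0 j) (tnth t j))).
have mF : measurable_fun setT F.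
  apply/measurable_EFinP; apply: measurable_prod => j _.
  apply: measurableT_comp; last exact: measurable_tnth.
  by apply/measurable_EFinP; exact: (measurable_int _ (ig j)).
split.
  apply: (integrable_pushforward (phi := @cons_point R d)) => //.
    exact: measurable_cons_point.
  by rewrite preimage_setT -/F Fcons.
rewrite -/F.
rewrite -[LHS]/(\int[pushforward prod (@cons_point R d)]_x F x)%E.
rewrite integral_pushforward//; last 2 first.
- exact: measurable_cons_point.
- by rewrite preimage_setT Fcons.
rewrite preimage_setT Fcons.
rewrite [LHS](@integral_tensor _ _ (measurableTypeR R) _ _ _ _ (g ord0)
    (fun t : Defs.point R d => \prod_(j < d) g (lift ord0 j) (tnth t j)))//.
by rewrite big_ord_recl; congr (_ * _)%:E; rewrite /Rintegral eT.
Qed.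

(** * Orthonormality of the half-period cosine basis *)

Lemma sin_pi_int (R : realType) (a : int) : sin (pi * a%:~R : R) = 0.
Proof.
have sinn n : sin (pi * n%:R : R) = 0.
  elim: n => [|n IH]; first by rewrite mulr0 sin0.
  by rewrite -natr1 mulrDr mulr1 sinDpi IH oppr0.
by case: a => n; [exact: sinn|rewrite NegzE mulrNz mulrN sinN sinn oppr0].
Qed.

Lemma continuous_integrable01 (R : realType) (f : R -> R) :
  continuous f ->
  (@lebesgue_measure R).-integrable `[0, 1]%classic (EFin \o f).
Proof.
move=> cf; apply: continuous_compact_integrable; first exact: segment_compact.
by apply: continuous_subspaceT.
Qed.

Lemma continuous_cosM (R : realType) (a : R) :
  continuous (fun x : R => cos (a * x)).
Proof.
move=> x; apply: (@continuous_comp _ _ _ (fun x : R => a * x) (@cos R)).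
  exact: mulrl_continuous.
exact: continuous_cos.
Qed.

(** For [a != 0] the antiderivative [sin (w x) / w] vanishes at 0 and at 1, since [w] is an integer
    multiple of [pi]. Negative [a] is allowed because differences of frequencies occur below. *)
Lemma integral_cos_int (R : realType) (a : int) :
  \int[@lebesgue_measure R]_(x in `[0, 1]) cos (pi * a%:~R * x) = (a == 0)%:R.
Proof.
have [->|a0] := eqVneq a 0.
  under eq_Rintegral do rewrite mulr0 mul0r cos0.
  rewrite Rintegral_cst//= lebesgue_measure_itv/= lte_fin ltr01.
  by rewrite oppr0 adde0 mulr1.
have w0 : pi * a%:~R != 0 :> R by rewrite mulf_neq0 ?intr_eq0// gt_eqF// pi_gt0.
set w := pi * a%:~R in w0 *.
have dF (x : R) : is_derive x 1 (fun x => w^-1 * sin (w * x)) (cos (w * x)).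
  have /= := @is_deriveZ _ _ _ _ w^-1 _ _ _
    (@is_derive1_comp _ (@sin R) ( *%R w) x _ _ (is_derive_sin _)
      (@is_deriveZ _ _ _ id w x 1 1 (is_derive_id _ _))).
  have -> : w^-1 *: (cos (w * x) * (w *: 1)) = cos (w * x) :> R.
    by rewrite /GRing.scale/=; field.
  exact.
rewrite /Rintegral (@continuous_FTC2 _ _ (fun x => w^-1 * sin (w * x)))//.
- by rewrite /= mulr1 mulr0 sin0 /w sin_pi_int !mulr0 subr0.
- by apply: continuous_subspaceT; exact: continuous_cosM.
- have cF : continuous (fun x : R => w^-1 * sin (w * x)).
    move=> x; apply: differentiable_continuous; apply/derivable1_diffP.
    by case: (dF x).
  split.
  + by move=> x _; case: (dF x).
  + exact/cvg_at_right_filter/cF.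
  + exact/cvg_at_left_filter/cF.
- by move=> x _; rewrite derive1E; case: (dF x).
Qed.

(** One factor [sqrt 2] goes to each nonzero frequency, which makes the basis function a tensor
    product. *)
Definition cosine1 (R : realType) (k : nat) (x : R) : R :=
  (if k != 0%N then Num.sqrt 2 else 1) * cos (pi * k%:R * x).

Lemma cosine_basisE (R : realType) d (k : {ffun 'I_d -> nat})
    (x : Defs.point R d) :
  cosine_basis k x = \prod_(j < d) cosine1 R (k j) (tnth x j).
Proof.
rewrite /cosine_basis /cosine1 big_split/=; congr (_ * _).
rewrite -big_mkcond/= prodr_const; congr (_ ^+ _).
by apply: eq_card => j; rewrite !inE.
Qed.

Lemma continuous_cosine1 (R : realType) k : continuous (cosine1 R k).
Proof. by move=> x; apply: cvgM; [exact: cvg_cst|exact: continuous_cosM]. Qed.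

(** The product-to-sum formula leaves cosines of frequencies [k + m] and [k - m], which integrate to
    0 unless the frequency is 0. *)
Lemma cosine1_orthonormal (R : realType) (k m : nat) :
  \int[@lebesgue_measure R]_(x in `[0, 1]) (cosine1 R k x * cosine1 R m x) =
  (k == m)%:R.
Proof.
have E x : cosine1 R k x * cosine1 R m x =
    ((if k != 0%N then Num.sqrt 2 else 1) *
      (if m != 0%N then Num.sqrt 2 else 1) / 2) *
    (cos (pi * (k%:Z + m%:Z)%:~R * x) + cos (pi * (k%:Z - m%:Z)%:~R * x)).
  have -> : pi * (k%:Z + m%:Z)%:~R * x = pi * k%:R * x + pi * m%:R * x.
    by rewrite intrD -!pmulrn; ring.
  have -> : pi * (k%:Z - m%:Z)%:~R * x = pi * k%:R * x - pi * m%:R * x.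
    by rewrite intrB -!pmulrn; ring.
  by rewrite /cosine1 cosD cosB; field.
under eq_Rintegral do rewrite E.
rewrite RintegralZl//; last first.
  apply: continuous_integrable01 => x.
  by apply: cvgD; exact: continuous_cosM.
rewrite RintegralD//; [|exact/continuous_integrable01/continuous_cosM..].
rewrite !integral_cos_int subr_eq0 -PoszD !eqz_nat addn_eq0.
(* For [k = m = 0] both integrals are 1 and the prefactor is 1/2; for [k = m != 0] only the
   difference survives and the prefactor is 1. *)
have [<-|km] := eqVneq k m.
  have [_|k0] := eqVneq k 0%N; rewrite /=; first by field.
  by rewrite -expr2 sqr_sqrtr// add0r mulr1 divff.
have [k0|k0] := eqVneq k 0%N; have [m0|m0] := eqVneq m 0%N;
  rewrite /= ?addr0 ?mulr0//.
by rewrite k0 m0 eqxx in km.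
Qed.

Section cosine_basis.
Context (R : realType) (d : nat).
Implicit Types k m : {ffun 'I_d -> nat}.

(** The indicator of the cube is a product of indicators of [[0, 1]], so extension by zero keeps the
    tensor form and the whole-space result [lebesgue_point_prod] applies. *)
Let patched k m j : R -> R :=
  (fun t => cosine1 R (k j) t * cosine1 R (m j) t) \_ `[0, 1]%classic.

Let basisM_patch k m :
  (fun x : Defs.point R d => cosine_basis k x * cosine_basis m x)
    \_ (@cube R d) =
  fun x => \prod_(j < d) patched k m j (tnth x j).
Proof.
apply/funext => x; rewrite patchE; case: ifPn => [|xN].
  rewrite inE cubeE => xc; rewrite !cosine_basisE -big_split/=.
  by apply: eq_bigr => j _; rewrite /patched patchE mem_set//; exact: xc.
have [j xj] : exists j, ~ `[0, 1]%classic (tnth x j : R).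
  by apply/existsNP => xc; move/negP: xN; apply; rewrite inE cubeE.
by rewrite (bigD1 j)//= /patched patchE memNset// mul0r.
Qed.

Let integrable_patched k m j :
  (@lebesgue_measure R).-integrable setT (EFin \o patched k m j).
Proof.
rewrite /patched -restrict_EFin; apply/integrable_restrict => //=; rewrite setTI.
apply: continuous_integrable01 => x.
by apply: cvgM; exact: continuous_cosine1.
Qed.

Lemma integrable_cosine_basisM k m : (lebesgue_point R d).-integrable
  (@cube R d) (fun x => (cosine_basis k x * cosine_basis m x)%:E).
Proof.
rewrite -[@cube R d]setTI; apply/integrable_restrict => //.
  exact: measurable_cube.
rewrite [X in _.-integrable _ X](restrict_EFin
  (fun x => cosine_basis k x * cosine_basis m x)) basisM_patch.
by have [] := lebesgue_point_prod R d _ (integrable_patched k m).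
Qed.

Lemma cosine_basis_orthonormal k m :
  \int[lebesgue_point R d]_(x in @cube R d)
    (cosine_basis k x * cosine_basis m x) = (k == m)%:R.
Proof.
rewrite Rintegral_mkcond basisM_patch /Rintegral.
rewrite (lebesgue_point_prod R d _ (integrable_patched k m)).2 /=.
under eq_bigr do rewrite /patched -Rintegral_mkcond cosine1_orthonormal.
have [<-|km] := eqVneq k m; first by rewrite big1// => j _; rewrite eqxx.
have [j kmj] : exists j, k j != m j.
  apply/existsP; apply: contraNT km => /existsPn kmE; apply/eqP/ffunP => j.
  by apply/eqP; rewrite -[_ == _]negbK kmE.
by rewrite (bigD1 j)//= (negbTE kmj) mul0r.
Qed.

Lemma measurable_cosine_basis k : measurable_fun setT
  (fun x : Defs.point R d => cosine_basis k x : measurableTypeR R).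
Proof.
rewrite (_ : (fun x => _) = fun x : Defs.point R d =>
    \prod_(j < d) cosine1 R (k j) (tnth x j)).
  apply: measurable_prod => j _.
  apply: measurableT_comp; last exact: measurable_tnth.
  by apply: continuous_measurable_fun; exact: continuous_cosine1.
by apply/funext => x; rewrite cosine_basisE.
Qed.

End cosine_basis.

(** * The complex modulus, and cosine polynomials as members of the cosine space *)

Lemma normcR (R : realType) (x : R) : Normc.normc x%:C = `|x|.
Proof. by rewrite /Normc.normc/= expr0n/= addr0 sqrtr_sqr. Qed.

Lemma normc_opp (R : rcfType) (x : R[i]) : Normc.normc (- x) = Normc.normc x.
Proof. exact: normcN. Qed.

Lemma normc_triangle (R : rcfType) (x y : R[i]) :
  Normc.normc (x + y) <= Normc.normc x + Normc.normc y.
Proof. exact: le_normcD. Qed.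

Lemma normc_ge0 (R : rcfType) (x : R[i]) : 0 <= Normc.normc x.
Proof. by case: x => u v; exact: sqrtr_ge0. Qed.

Section cosine_polynomial.
Context (R : realType) (d : nat).
Implicit Types (A : {fset {ffun 'I_d -> nat}}) (c : {ffun 'I_d -> nat} -> R).

(** Real coefficients suffice: the extremal functions are built from the real numbers
    [b_k / r_k]. *)
Definition cosine_poly A c (x : Defs.point R d) : R[i] :=
  (\sum_(k <- A) c k * cosine_basis k x)%:C.

Lemma cosine_coef_poly A c m :
  cosine_coef (cosine_poly A c) m = (if m \in A then c m else 0)%:C.
Proof.
rewrite /cosine_coef /cube_integral /cosine_poly.
under eq_Rintegral do rewrite -rmorphM/= mulr_suml.
under [X in _ +i* X]eq_Rintegral do rewrite -rmorphM/=.
rewrite Rintegral_cst ?mul0r; last exact: measurable_cube.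
congr (_ +i* _); rewrite /Rintegral.
under eq_integral do rewrite -sumEFin.
have fE k : (fun x : Defs.point R d =>
      (c k * cosine_basis k x * cosine_basis m x)%:E) =
    (fun x => (c k)%:E * (cosine_basis k x * cosine_basis m x)%:E)%E.
  by apply/funext => x; rewrite -mulrA EFinM.
have ikm k := @integrable_cosine_basisM R d k m.
rewrite integral_sum//=; [|exact: measurable_cube|]; last first.
  by move=> k; rewrite fE; apply: integrableZl => //; exact: measurable_cube.
rewrite (eq_bigr (fun k => (c k * (k == m)%:R)%:E)); last first.
  move=> k _; rewrite fE integralZl//; last exact: measurable_cube.
  rewrite -cosine_basis_orthonormal EFinM fineK//.
  by apply: integrable_fin_num => //; exact: measurable_cube.
rewrite sumEFin /=; case: ifPn => mA.
  rewrite (big_fsetD1 m)//= eqxx mulr1 big_seq big1 ?addr0// => k.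
  by rewrite !inE => /andP[/negPf -> _]; rewrite mulr0.
rewrite big_seq big1// => k kA; case: eqVneq => [km|_]; last by rewrite mulr0.
by rewrite -km kA in mA.
Qed.

Lemma cosine_sqnorm_poly alpha gamma A c :
  (forall k : {ffun 'I_d -> int}, 0 <= weight alpha gamma k) ->
  cosine_sqnorm alpha gamma (cosine_poly A c) =
  (\sum_(k <- A) c k ^+ 2 * weight alpha gamma [ffun j => (k j)%:Z])%:E.
Proof.
move=> w0; rewrite /cosine_sqnorm.
transitivity (\esum_(k in [set` A])
    (c k ^+ 2 * weight alpha gamma [ffun j => (k j)%:Z])%:E)%E.
  rewrite [RHS]esum_mkcond; apply: eq_esum => k _.
  rewrite cosine_coef_poly mem_setE normcR real_normK ?num_real//.
  by case: ifPn => kA //; rewrite expr0n mul0r.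
rewrite esum_fset//; last by move=> k _; rewrite lee_fin mulr_ge0 ?sqr_ge0.
by rewrite -fsbig_seq ?fset_uniq// -sumEFin.
Qed.

Lemma square_integrable_poly A c : square_integrable (cosine_poly A c).
Proof.
have mRe : measurable_fun setT (fun x : Defs.point R d =>
    \sum_(k <- A) c k * cosine_basis k x : measurableTypeR R).
  apply: measurable_sum => k; apply: measurable_funM => //.
  exact: measurable_cosine_basis.
split.
- exact: measurable_funTS.
- exact: measurable_cst.
have i2 : (lebesgue_point R d).-integrable (@cube R d)
    (fun x => ((\sum_(k <- A) c k * cosine_basis k x) ^+ 2)%:E).
  (* The square is expanded into a double sum of products of two basis functions, each integrable on
     the cube. *)
  rewrite (_ : (fun x => _) = (fun x => \sum_(k <- A) \sum_(m <- A)
      (c k * c m)%:E * (cosine_basis k x * cosine_basis m x)%:E)%E); last first.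
    apply/funext => x; rewrite expr2 mulr_suml -sumEFin; apply: eq_bigr => k _.
    rewrite mulr_sumr -sumEFin; apply: eq_bigr => m _.
    by rewrite -EFinM; congr EFin; ring.
  apply: integrable_sum => [|k _]; first exact: measurable_cube.
  apply: integrable_sum => [|m _]; first exact: measurable_cube.
  apply: integrableZl; first exact: measurable_cube.
  exact: integrable_cosine_basisM.
under eq_integral do rewrite /cosine_poly normcR real_normK ?num_real//.
by apply: integrable_lty i2; exact: measurable_cube.
Qed.

(** The net of partial sums is constant from the index [A] on. *)
Lemma is_cosine_representative_poly A c :
  is_cosine_representative (cosine_poly A c).
Proof.
move=> x _.
apply: (@cvg_near_cst {fset {ffun 'I_d -> nat}} R[i]^o _ (fun B => \sum_(k <- B)
  cosine_coef (cosine_poly A c) k * (cosine_basis k x)%:C)).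
  exact: totally_filter.
exists A => // B /= AB; rewrite /cosine_poly rmorph_sum/=.
under eq_bigr do rewrite cosine_coef_poly -rmorphM/=.
rewrite -(big_fset_incl _ AB)/= => [|k _ /negPf ->]; last by rewrite mul0r.
by rewrite big_seq [RHS]big_seq; apply: eq_bigr => k ->.
Qed.

End cosine_polynomial.

(** * The tent transformation and exponential sums over the lattice points *)

Lemma cosB2pi_int (R : realType) (x : R) (a : int) :
  cos (x - 2 * pi * a%:~R) = cos x.
Proof.
have s0 := sin_pi_int R a.
have -> : 2 * pi * a%:~R = (pi * a%:~R) *+ 2 :> R by rewrite -mulr_natl; ring.
rewrite cosB cos_mulr2n sin_mulr2n s0 cos2sin2 s0.
by rewrite !(mulr0, expr0n)/= mul0rn mulr0; ring.
Qed.

(** With [u] the fractional part of [y], the tent value is [2u] or [2 - 2u]. Evenness and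
    periodicity of the cosine identify the two cases, and periodicity then replaces [u] by [y]. *)
Lemma cos_tent (R : realType) (k : nat) (y : R) :
  cos (pi * k%:R * tent (frac_part y)) = cos (2 * pi * (k%:R * y)).
Proof.
have tE : cos (pi * k%:R * tent (frac_part y)) =
    cos (2 * pi * k%:R * frac_part y).
  rewrite /tent; case: ger0P => _.
    rewrite -[RHS]cosN -[RHS](cosB2pi_int _ _ (- k%:Z)) mulrNz -pmulrn.
    by congr cos; ring.
  by congr cos; ring.
rewrite tE -[RHS](cosB2pi_int _ _ (k%:Z * Num.floor y)) intrM -pmulrn.
by rewrite /frac_part; congr cos; ring.
Qed.

(** The exponential [e^(i x)] of a real angle. *)
Definition cis (R : realType) (x : R) : R[i] := cos x +i* sin x.

Lemma cis0 (R : realType) : cis R 0 = 1.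
Proof. by rewrite /cis cos0 sin0. Qed.

Lemma cisD (R : realType) (x y : R) : cis R (x + y) = cis R x * cis R y.
Proof.
by rewrite /cis cosD sinD; apply/eqP; rewrite eq_complex/= addrC eqxx/= addrC.
Qed.

Lemma cis_sum (R : realType) (I : finType) (F : I -> R) :
  cis R (\sum_i F i) = \prod_i cis R (F i).
Proof. by apply: (big_morph _ (cisD R) (cis0 R)). Qed.

Lemma cisX (R : realType) (x : R) n : cis R (x * n%:R) = cis R x ^+ n.
Proof.
elim: n => [|n IH]; first by rewrite mulr0 expr0 cis0.
by rewrite -natr1 mulrDr mulr1 cisD IH exprSr.
Qed.

(** Each cosine is the mean of [e^(i x)] and [e^(- i x)]; distributing the product over these sums
    yields one exponential per sign vector, and real parts are taken. *)
Lemma prod_cos (R : realType) (d : nat) (F : 'I_d -> R) :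
  \prod_j cos (F j) = (2 ^+ d)^-1 *
    \sum_(s : {ffun 'I_d -> bool}) cos (\sum_j (-1) ^+ s j * F j).
Proof.
have cosE (x : R) : (cos x)%:C = 2^-1 * \sum_(b : bool) cis R ((-1) ^+ b * x).
  rewrite big_bool/= expr1 expr0 mulN1r mul1r /cis cosN sinN.
  have -> : (cos x -i* sin x) + (cos x +i* sin x) = 2 * (cos x)%:C.
    by apply/eqP; rewrite eq_complex/=; apply/andP; split; apply/eqP; ring.
  by rewrite mulKf// pnatr_eq0.
have /(congr1 (@complex.Re R)) : (\prod_j cos (F j))%:C = ((2 ^+ d)^-1)%:C *
    \sum_(s : {ffun 'I_d -> bool}) cis R (\sum_j (-1) ^+ s j * F j).
  rewrite rmorph_prod/=.
  under eq_bigr do rewrite cosE.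
  rewrite big_split/= prodr_const card_ord bigA_distr_bigA/=.
  under eq_bigr do rewrite -cis_sum.
  by rewrite fmorphV rmorphXn/= rmorph_nat exprVn.
have ReM (a : R) (w : R[i]) : complex.Re (a%:C * w) = a * complex.Re w.
  by case: w => x y; rewrite /= mul0r subr0.
by rewrite ReM raddf_sum.
Qed.

(** If [n] divides [m], every term is 1. Otherwise the sum is the real part of a full geometric sum
    with ratio [w != 1] and [w ^+ n = 1], hence 0. *)
Lemma sum_cos_lattice (R : realType) (n : nat) (m : int) : (0 < n)%N ->
  \sum_(1 <= i < n.+1) cos (2 * pi * (i%:R * m%:~R / n%:R)) =
  n%:R * (n%:Z %| m)%Z%:R :> R.
Proof.
move=> n0; have nR : n%:R != 0 :> R by rewrite pnatr_eq0 -lt0n.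
have [/dvdzP[q ->]|mN] := boolP (n%:Z %| m)%Z.
  under eq_bigr => i _.
    rewrite -(cosB2pi_int _ _ (i%:Z * q)) !intrM -!pmulrn.
    rewrite (_ : _ - _ = 0); last by field.
    rewrite cos0; over.
  by rewrite sumr_const_nat subn1 mulr1.
pose r : nat := absz (m %% n%:Z)%Z.
have rE : (m %% n%:Z)%Z = r.
  by rewrite /r gez0_abs// modz_ge0// eqz_nat -lt0n.
have r0 : (0 < r)%N.
  rewrite lt0n; apply: contra mN => /eqP r0; apply/dvdz_mod0P.
  by rewrite rE r0.
have rn : (r < n)%N by rewrite -ltz_nat -rE ltz_pmod// ltz_nat.
(* Half the angle of the ratio: it lies strictly between 0 and [pi], so [sin t > 0], and
   [cos (2t) = 1 - 2 sin^2 t] then excludes [w = 1]. *)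
pose t : R := pi * (r%:R / n%:R).
have t0 : 0 < sin t.
  apply: sin_gt0_pi; rewrite mulr_gt0 ?pi_gt0 ?divr_gt0 ?ltr0n//=.
  by rewrite gtr_pMr ?pi_gt0// ltr_pdivrMr ?ltr0n// mul1r ltr_nat.
pose w := cis R (t *+ 2).
have w1 : w != 1.
  apply/eqP => -[+ _]; rewrite cos_mulr2n cos2sin2 => E.
  have /eqP : sin t ^+ 2 = 0 by lra.
  by rewrite expf_eq0/= gt_eqF.
have tn : t *+ 2 * n%:R = 2 * pi * r%:R by rewrite /t; field.
have wn : w ^+ n = 1.
  rewrite -cisX tn /cis -(cosB2pi_int _ _ r) subrr cos0 -mulrA mulr_natl.
  by rewrite sin_mulr2n (sin_pi_int R r) mulr0 mul0rn.
have wS : \sum_(i < n) w ^+ i = 0.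
  apply/eqP; have := subrX1 w n; rewrite wn subrr => /esym/eqP.
  by rewrite mulf_eq0 subr_eq0 (negPf w1).
(* Removing [i * (m %/ n)] full turns replaces [m] by its remainder [r]. *)
under eq_bigr => i _.
  rewrite -(cosB2pi_int _ _ (i%:Z * (m %/ n%:Z)%Z)) {1}(divz_eq m n%:Z) rE.
  rewrite (_ : _ - _ = t *+ 2 * i%:R); last first.
    by rewrite intrD !intrM -!pmulrn /t; field.
  rewrite (_ : cos _ = complex.Re (w ^+ i)); last by rewrite -cisX.
  over.
(* The exponents run from 1 to [n]; one factor [w] is taken out to reach the exponents 0 to [n - 1]
   of [wS]. *)
rewrite /= mulr0 big_add1/= big_mkord -(raddf_sum (@complex.Re R)).
under eq_bigr do rewrite exprS.
by rewrite -mulr_sumr wS mulr0.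
Qed.

(** * Values of the rule on the basis, and symmetry under sign changes *)

Section lattice_coef.
Context (R : realType) (d n : nat) (z : {ffun 'I_d -> 'I_n}).
Implicit Types (k : {ffun 'I_d -> nat}) (h : {ffun 'I_d -> int}).
Implicit Types s : {ffun 'I_d -> bool}.

Definition ffun_int k : {ffun 'I_d -> int} := [ffun j => (k j)%:Z].

(** The bracketed factor of the theorem: the proportion of sign vectors that carry [h] into the dual
    lattice. *)
Definition dual_frequency h : R :=
  (2 ^+ d)^-1 *
  \sum_(s : {ffun 'I_d -> bool}) (dual_lattice z (flip_signs s h))%:R.

Definition lattice_coef k : R :=
  Num.sqrt 2 ^+ #|[set j | k j != 0%N]%SET| * dual_frequency (ffun_int k).

Lemma tent_lattice_cosine_basis k : (0 < n)%N ->
  n%:R^-1 * (\sum_(1 <= i < n.+1) cosine_basis k (tent_lattice_point R z i)) =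
  lattice_coef k.
Proof.
move=> n0; have nR : n%:R != 0 :> R by rewrite pnatr_eq0 -lt0n.
have phiE i : cosine_basis k (tent_lattice_point R z i) =
    Num.sqrt 2 ^+ #|[set j | k j != 0%N]%SET| * ((2 ^+ d)^-1 *
    \sum_(s : {ffun 'I_d -> bool}) cos (2 * pi * (i%:R *
      (\sum_(j < d) flip_signs s (ffun_int k) j * (z j)%:Z)%:~R / n%:R))).
  rewrite /cosine_basis; congr (_ * _).
  under eq_bigr do rewrite tnth_mktuple cos_tent.
  rewrite prod_cos; congr (_ * _); apply: eq_bigr => s _; congr cos.
  rewrite rmorph_sum/= mulr_sumr mulr_suml mulr_sumr; apply: eq_bigr => j _.
  rewrite !ffunE !intrM -!pmulrn rmorph_sign.
  by field.
under eq_bigr do rewrite phiE.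
rewrite -mulr_sumr -mulr_sumr exchange_big/=.
under eq_bigr do rewrite sum_cos_lattice//.
rewrite -mulr_sumr /lattice_coef /dual_frequency; field.
by rewrite nR expf_neq0.
Qed.

Lemma flip_signsK s : involutive (flip_signs s).
Proof.
by move=> h; apply/ffunP => j; rewrite !ffunE mulrA -expr2 sqrr_sign mul1r.
Qed.

(** Sign changes form a group, so composing with [s], a componentwise exclusive or, only permutes
    the terms. *)
Lemma dual_frequency_flip s h :
  dual_frequency (flip_signs s h) = dual_frequency h.
Proof.
rewrite /dual_frequency; congr (_ * _).
pose f (t : {ffun 'I_d -> bool}) := [ffun j => t j (+) s j].
have fK : involutive f by move=> t; apply/ffunP => j; rewrite !ffunE addbK.
rewrite (reindex f); last by exists f => t _; exact: fK.
apply: eq_bigr => t _; congr (dual_lattice _ _)%:R.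
apply/ffunP => j; rewrite !ffunE signr_addb mulrA -[_ * _ * (-1) ^+ _]mulrA.
by rewrite -expr2 sqrr_sign mulr1.
Qed.

Lemma weight_flip (alpha : R) (gamma : nat -> R) s h :
  weight alpha gamma (flip_signs s h) = weight alpha gamma h.
Proof.
apply: eq_bigr => j _; rewrite /weight1 ffunE.
by rewrite mulf_eq0 signr_eq0/= normrM normr_sign mul1r.
Qed.

Lemma flip_signs_eq0 s h : (flip_signs s h == 0) = (h == 0).
Proof.
have f0 : flip_signs s 0 = 0 by apply/ffunP => j; rewrite !ffunE mulr0.
by rewrite -(inj_eq (can_inj (flip_signsK s))) flip_signsK f0.
Qed.

Lemma weight_gt0 (alpha : R) (gamma : nat -> R) h :
  (forall j, 0 < gamma j) -> 0 < weight alpha gamma h.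
Proof.
move=> g0; apply: prodr_gt0 => j _; rewrite /weight1; case: eqVneq => // h0.
by rewrite divr_gt0// powR_gt0// ltr0z normr_gt0.
Qed.

Lemma dual_frequency_ge0 h : 0 <= dual_frequency h.
Proof. by rewrite mulr_ge0 ?invr_ge0 ?exprn_ge0// sumr_ge0. Qed.

(* Replacing h by sigma(h) is a bijection which preserves every factor except
   membership in the dual lattice, so that membership may be averaged over all
   sign vectors. *)
Lemma esum_dual_lattice_average (F : {ffun 'I_d -> int} -> R) :
  (forall h, 0 <= F h) -> (forall s h, F (flip_signs s h) = F h) ->
  \esum_(h in [set h | h != 0 /\ dual_lattice z h]) (F h)%:E =
  \esum_(h in [set h | h != 0]) (F h * dual_frequency h)%:E.
Proof.
move=> F0 Fs.
pose nz : set {ffun 'I_d -> int} := [set h | h != 0].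
pose G s h : \bar R :=
  ((2 ^+ d)^-1 * (F h * (dual_lattice z (flip_signs s h))%:R))%:E.
have G0 s h : (0 <= G s h)%E.
  by rewrite lee_fin !mulr_ge0 ?invr_ge0 ?exprn_ge0.
transitivity (\sum_(s : {ffun 'I_d -> bool}) \esum_(h in nz) G s h)%E; last first.
  rewrite -esum_sum//; apply: eq_esum => h _; rewrite sumEFin -mulr_sumr.
  by rewrite -mulr_sumr /dual_frequency mulrCA.
pose G1 h : \bar R := ((2 ^+ d)^-1 * (F h * (dual_lattice z h)%:R))%:E.
transitivity (\sum_(s : {ffun 'I_d -> bool}) \esum_(h in nz) G1 h)%E.
  rewrite -esum_sum//; last first.
    by move=> *; rewrite lee_fin !mulr_ge0 ?invr_ge0 ?exprn_ge0.
  rewrite (_ : [set h | h != 0 /\ dual_lattice z h] = nz `&` dual_lattice z)//.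
  rewrite esum_mkcondr; apply: eq_esum => h _.
  (* The same term occurs for each of the [2 ^ d] sign vectors, which cancels the prefactor. *)
  rewrite sumEFin sumr_const card_ffun card_ord card_bool.
  rewrite -[_ *+ _]mulr_natl natrX mulVKf ?expf_neq0//.
  rewrite (_ : (h \in _) = dual_lattice z h); last by apply/idP/idP; rewrite inE.
  by case: (dual_lattice z h); rewrite ?mulr1 ?mulr0.
apply: eq_bigr => s _.
rewrite (reindex_esum nz nz (flip_signs s)).
  by apply: eq_esum => h _; rewrite /G1 Fs.
split.
- by move=> h; rewrite /nz/= flip_signs_eq0.
- by move=> h1 h2 _ _; exact: can_inj (flip_signsK s) _ _.
- move=> h h0; exists (flip_signs s h); last exact: flip_signsK.
  by rewrite /nz/= flip_signs_eq0.
Qed.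

End lattice_coef.

(** * Folding sums over [Z^d] into sums over [N^d] *)

Section absolute_values.
Context (R : realType) (d : nat).
Implicit Types (k : {ffun 'I_d -> nat}) (h : {ffun 'I_d -> int}).

(* h is encoded by its absolute values and the set of its negative entries. *)
Let signed (p : {ffun 'I_d -> nat} * {set 'I_d}) : {ffun 'I_d -> int} :=
  [ffun j => (-1) ^+ (j \in p.2) * (p.1 j)%:Z].

(** [F] depends only on the absolute values, and [k] is shared by as many [h] as its support has
    subsets. Restricting the negative entries to the support, as [J] does, makes the encoding
    injective. *)
Lemma esum_absolute_values (F : {ffun 'I_d -> int} -> R) :
  (forall h, 0 <= F h) -> (forall s h, F (flip_signs s h) = F h) ->
  \esum_(h in [set h | h != 0]) (F h)%:E =
  \esum_(k in [set k | k != [ffun=> 0%N]])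
    (2 ^+ #|[set j | k j != 0%N]%SET| * F (ffun_int d k))%:E.
Proof.
move=> F0 Fs.
pose nz : set {ffun 'I_d -> nat} := [set k | k != [ffun=> 0%N]].
pose J k := [set s : {set 'I_d} | s \subset [set j | k j != 0%N]%SET].
have FE p : F (signed p) = F (ffun_int d p.1).
  rewrite -[RHS](Fs [ffun j => j \in p.2]); congr F.
  by apply/ffunP => j; rewrite !ffunE.
transitivity (\esum_(k in nz) \esum_(s in J k) (F (ffun_int d k))%:E); last first.
  apply: eq_esum => k _.
  rewrite (_ : J k = [set` enum (powerset [set j | k j != 0%N]%SET)]); last first.
    by apply/seteqP; split => s /=; rewrite mem_enum powersetE.
  rewrite esum_fset//; last by move=> *; rewrite lee_fin.
  rewrite -fsbig_seq ?enum_uniq// big_enum/= sumEFin sumr_const card_powerset.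
  by rewrite -[_ *+ _]mulr_natl natrX.
rewrite esum_esum//=; last by move=> *; rewrite lee_fin.
rewrite (reindex_esum (nz `*`` J) _ signed).
  by apply: eq_esum => p _; rewrite FE.
have absE (b : bool) (m : nat) : absz ((-1) ^+ b * m%:Z) = m.
  by rewrite abszM abszX absz_nat/=; case: b; rewrite ?expr0 ?mul1n.
split.
- move=> [k s] /= [k0 _]; apply: contra k0 => /eqP/ffunP E; apply/eqP/ffunP => j.
  by move/(_ j)/(congr1 absz): E; rewrite !ffunE/= absE.
- move=> [k s] [k' s']; rewrite !inE => -[/= _ Js] [/= _ Js'] /ffunP E.
  have kE : k = k'.
    apply/ffunP => j; move/(_ j)/(congr1 absz): (E).
    by rewrite !ffunE/= !absE.
  rewrite kE in Js E *; congr pair; apply/setP => j.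
  (* The sign of a zero entry is invisible in [h]; there [J] forces [j] out of both sets. *)
  have [kj|kj] := eqVneq (k' j) 0%N.
    have Nj (t : {set 'I_d}) : J k' t -> j \notin t.
      move=> /fintype.subsetP/(_ j); rewrite inE kj.
      by case: (j \in t) => // /(_ isT).
    by rewrite (negPf (Nj _ Js)) (negPf (Nj _ Js')).
  have := E j; rewrite !ffunE/= => /(mulIf _).
  rewrite eqz_nat => /(_ kj).
  by case: (j \in s); case: (j \in s').
- move=> h /= h0.
  exists ([ffun j => `|h j|%N], [set j | h j < 0]%SET) => /=; last first.
    apply/ffunP => j; rewrite !ffunE/= inE.
    have [hj|hj] := ltP (h j) 0; last by rewrite expr0 mul1r gez0_abs.
    by rewrite expr1 mulN1r ltz0_abs// opprK.
  split.
    apply: contra h0 => /eqP/ffunP E; apply/eqP/ffunP => j.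
    by move/(_ j)/eqP: E; rewrite !ffunE absz_eq0 => /eqP.
  by apply/fintype.subsetP => j; rewrite !inE ffunE absz_eq0 => /lt_eqF ->.
Qed.

End absolute_values.

(** * Cauchy-Schwarz with weights, and limits of finite sums *)

(** The quadratic form [E] in [(a, b)] is a weighted sum of squares, hence nonnegative; suitable
    [(a, b)] give the inequality. *)
Lemma weighted_cauchy_schwarz (R : realFieldType) (I : Type) (s : seq I)
    (u v r : I -> R) : (forall i, 0 < r i) ->
  (\sum_(i <- s) u i * v i) ^+ 2 <=
  (\sum_(i <- s) u i ^+ 2 * r i) * (\sum_(i <- s) v i ^+ 2 / r i).
Proof.
move=> r0.
set B := \sum_(i <- s) _; set A := (\sum_(i <- s) u i ^+ 2 * r i).
set V := \sum_(i <- s) v i ^+ 2 / r i.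
have A0 : 0 <= A by apply: sumr_ge0 => i _; rewrite mulr_ge0 ?sqr_ge0// ltW.
have V0 : 0 <= V by apply: sumr_ge0 => i _; rewrite divr_ge0 ?sqr_ge0// ltW.
have E (a b : R) : 0 <= a ^+ 2 * A - 2 * a * b * B + b ^+ 2 * V.
  have -> : a ^+ 2 * A - 2 * a * b * B + b ^+ 2 * V =
      \sum_(i <- s) r i * (a * u i - b * (v i / r i)) ^+ 2.
    rewrite !mulr_sumr -sumrB -big_split/=; apply: eq_bigr => i _.
    by field; rewrite gt_eqF.
  by apply: sumr_ge0 => i _; rewrite mulr_ge0 ?sqr_ge0// ltW.
have [VA|V_gt0] := eqVneq V 0; last first.
  have := E V B.
  have -> : V ^+ 2 * A - 2 * V * B * B + B ^+ 2 * V = V * (A * V - B ^+ 2).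
    by ring.
  by rewrite pmulr_rge0 ?subr_ge0// lt_def V_gt0.
(* For [V = 0] this choice gives [- B^2 (A + 2) >= 0], hence [B = 0]; the added 1 is convenient
   since [A] itself may vanish. *)
have := E B (A + 1); rewrite VA; nra.
Qed.

Lemma cvg_sum_seq (K : numFieldType) (V : normedModType K) (T : Type)
    (F : set_system T) (FF : Filter F) (I : Type) (s : seq I)
    (f : I -> T -> V) (l : I -> V) :
  (forall i, f i x @[x --> F] --> l i) ->
  \sum_(i <- s) f i x @[x --> F] --> \sum_(i <- s) l i.
Proof.
move=> fl; elim: s => [|i s IH].
  by under eq_cvg do rewrite big_nil; rewrite big_nil; exact: cvg_cst.
by under eq_cvg do rewrite big_cons; rewrite big_cons; exact: cvgD.
Qed.

(** * The squared worst-case error as a sum over [N^d] *)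

Section worst_case.
Context (R : realType) (d n : nat) (alpha : R) (gamma : nat -> R).
Context (z : {ffun 'I_d -> 'I_n}).
Context (n_gt0 : (0 < n)%N) (gamma_gt0 : forall j, 0 < gamma j).
Implicit Types (k : {ffun 'I_d -> nat}) (A : {fset {ffun 'I_d -> nat}}).

Local Notation k0 := ([ffun=> 0%N] : {ffun 'I_d -> nat}).
Local Notation r k := (weight alpha gamma (ffun_int d k)).
Local Notation b k := (lattice_coef R d n z k).
Local Notation pt i := (tent_lattice_point R z i).

Lemma cosine_basis0 (x : Defs.point R d) : cosine_basis k0 x = 1.
Proof.
rewrite /cosine_basis (_ : [set j | _]%SET = finset.set0) ?cards0 ?mul1r.
  by rewrite big1// => j _; rewrite ffunE mulr0 mul0r cos0.
by apply/setP => j; rewrite !inE ffunE.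
Qed.

Lemma cube_integralE (f : Defs.point R d -> R[i]) :
  cube_integral f = cosine_coef f k0.
Proof.
by congr cube_integral; apply/funext => x; rewrite cosine_basis0 mulr1.
Qed.

Lemma lattice_coef0 : b k0 = 1.
Proof.
rewrite -tent_lattice_cosine_basis//.
under eq_bigr do rewrite cosine_basis0.
by rewrite sumr_const_nat subn1 mulVf// pnatr_eq0 -lt0n.
Qed.

(** Required because the cosine series is known to represent [f] only inside the cube. *)
Lemma tent_lattice_point_cube i : cube (pt i).
Proof.
move=> j; rewrite tnth_mktuple /tent /frac_part.
set y : R := _ / _; have /andP[] := floor_itv y.
rewrite intrD mulr1z => y0 y1.
case: (ger0P (_ - 1)) => ?; apply/andP; split; lra.
Qed.

(** The rule is a finite combination of point evaluations, each a limit along the same net, so it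
    may be applied termwise to the cosine series. *)
Lemma tent_lattice_rule_cvg (f : Defs.point R d -> R[i]) :
  is_cosine_representative f ->
  ((\sum_(k <- A) cosine_coef f k * (b k)%:C : R[i]^o)
     @[A --> @totally {ffun 'I_d -> nat}] --> (tent_lattice_rule z f : R[i]^o)).
Proof.
move=> fr.
have cvgS (s : seq nat) :
    (n%:R^-1 * \sum_(i <- s) \sum_(k <- A)
        cosine_coef f k * (cosine_basis k (pt i))%:C : R[i]^o)
      @[A --> @totally {ffun 'I_d -> nat}] -->
    (n%:R^-1 * \sum_(i <- s) f (pt i) : R[i]^o).
  have FF : Filter (@totally {ffun 'I_d -> nat}) by exact: totally_filter.
  apply: (cvgMl_tmp (a := n%:R^-1) (g := fun A : {fset {ffun 'I_d -> nat}} =>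
    \sum_(i <- s) \sum_(k <- A) cosine_coef f k * (cosine_basis k (pt i))%:C)).
  apply: (@cvg_sum_seq R[i] R[i]^o _ totally FF _ s
    (fun i A => \sum_(k <- A) cosine_coef f k * (cosine_basis k (pt i))%:C)
    (fun i => f (pt i))) => i.
  by apply: fr; exact: tent_lattice_point_cube.
have bE (A : {fset {ffun 'I_d -> nat}}) :
    \sum_(k <- A) cosine_coef f k * (b k)%:C =
    n%:R^-1 * \sum_(i <- index_iota 1 n.+1) \sum_(k <- A)
      cosine_coef f k * (cosine_basis k (pt i))%:C.
  rewrite exchange_big mulr_sumr/=; apply: eq_bigr => k _.
  rewrite -mulr_sumr mulrCA -tent_lattice_cosine_basis// rmorphM fmorphV.
  by rewrite rmorph_nat rmorph_sum.
rewrite (eq_cvg _ _ bE).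
exact: (cvgS (index_iota 1 n.+1)).
Qed.

Lemma tent_lattice_rule_poly A (c : {ffun 'I_d -> nat} -> R) :
  tent_lattice_rule z (cosine_poly R d A c) = (\sum_(k <- A) c k * b k)%:C.
Proof.
rewrite /tent_lattice_rule /cosine_poly -rmorph_sum exchange_big/=.
rewrite -(rmorph_nat (real_complex R)) -fmorphV -rmorphM mulr_sumr; congr _%:C.
apply: eq_bigr => k _.
by rewrite -mulr_sumr mulrCA -tent_lattice_cosine_basis.
Qed.

Let r_gt0 k : 0 < r k. Proof. exact: weight_gt0. Qed.

(** The squared norm of the error functional, that is, of its Riesz representer. *)
Definition lattice_error : \bar R :=
  \esum_(k in [set k | k != k0]) (b k ^+ 2 / r k)%:E.

Lemma lattice_error_ge0 : (0 <= lattice_error)%E.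
Proof.
by apply: esum_ge0 => k _; rewrite lee_fin divr_ge0 ?sqr_ge0// ltW.
Qed.

Lemma tent_lattice_rule_le (f : Defs.point R d -> R[i]) :
  cosine_space alpha gamma f -> (cosine_norm alpha gamma f <= 1)%E ->
  ((Normc.normc (cube_integral f - tent_lattice_rule z f))%:E <=
   sqrte lattice_error)%E.
Proof.
move=> [_ _ frep] fnorm.
have f1 : (cosine_sqnorm alpha gamma f <= 1)%E.
  rewrite -(@lee_sqrt R _ 1)//; apply: (le_trans fnorm).
  by rewrite /= sqrtr1.
have := lattice_error_ge0.
case E : lattice_error => [w| |]//= w0; last by rewrite leey.
rewrite lee_fin in w0; rewrite lee_fin.
pose S A := \sum_(k <- A) cosine_coef f k * (b k)%:C.
(* Since [b_0 = 1] and the integral is the coefficient at [k0], the [k0] term cancels;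
   Cauchy-Schwarz bounds the rest uniformly in [A]. *)
have bound A : k0 \in A -> Normc.normc (cube_integral f - S A) <= Num.sqrt w.
  move=> k0A; rewrite cube_integralE /S (big_fsetD1 k0)//= lattice_coef0 mulr1.
  rewrite opprD addrA subrr add0r normc_opp.
  have le1 : \sum_(k <- (A `\ k0)%fset)
      Normc.normc (cosine_coef f k) ^+ 2 * r k <= 1.
    rewrite -lee_fin -sumEFin; apply: le_trans f1; apply: esum_ge.
    by exists [set` (A `\ k0)%fset] => //; rewrite -fsbig_seq ?fset_uniq.
  have le2 : \sum_(k <- (A `\ k0)%fset) b k ^+ 2 / r k <= w.
    rewrite -lee_fin -sumEFin -E; apply: esum_ge.
    exists [set` (A `\ k0)%fset]; last by rewrite -fsbig_seq ?fset_uniq.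
    by split => // k /=; rewrite !inE => /andP[].
  have le3 :
      Normc.normc (\sum_(k <- (A `\ k0)%fset) cosine_coef f k * (b k)%:C) <=
      \sum_(k <- (A `\ k0)%fset) Normc.normc (cosine_coef f k) * `|b k|.
    elim/big_ind2 : _ => [|x x' y y' xx' yy'|k _].
    - by rewrite Normc.normc0.
    - by apply: (le_trans (normc_triangle _ _ _)); exact: lerD.
    - by rewrite Normc.normcM normcR.
  apply: (le_trans le3); rewrite -ler_sqr ?nnegrE ?sqrtr_ge0//; last first.
    by apply: sumr_ge0 => k _; rewrite mulr_ge0// normc_ge0.
  rewrite sqr_sqrtr//.
  apply: (le_trans (weighted_cauchy_schwarz _ _ _ _ _ _ r_gt0)).
  rewrite -[w]mul1r; apply: ler_pM => //.
  - by apply: sumr_ge0 => k _; rewrite mulr_ge0 ?sqr_ge0// ltW.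
  - by apply: sumr_ge0 => k _; rewrite divr_ge0 ?sqr_ge0// ltW.
  - by under eq_bigr do rewrite real_normK ?num_real//.
(* The uniform bound passes to the limit of [S A] with an arbitrary tolerance [e], embedded in
   [R[i]] because the norm of [R[i]^o] takes its values there. *)
apply/ler_addgt0Pr => e e0.
have e0C : 0 < e%:C by rewrite ltcR.
have FF := @totally_filter {ffun 'I_d -> nat}.
have cvgS := tent_lattice_rule_cvg _ frep.
have [A0 _ A0e] := @cvgr_dist_lt R[i] R[i]^o _ _ FF S _ cvgS _ e0C.
(* Adding [k0] to the index set makes [bound] applicable. *)
have := A0e (A0 `|` [fset k0])%fset (fsubsetUl _ _); rewrite /= -/(S _).
set A := (A0 `|` _)%fset => Ae.
have {}Ae : Normc.normc (tent_lattice_rule z f - S A) < e by rewrite -ltcR.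
have k0A : k0 \in A by rewrite !inE eqxx orbT.
have -> : cube_integral f - tent_lattice_rule z f =
  (cube_integral f - S A) - (tent_lattice_rule z f - S A) by ring.
apply: (le_trans (normc_triangle _ _ _)); rewrite normc_opp.
by rewrite lerD ?bound// ltW.
Qed.

(* The extremal functions are the truncated Riesz representers
   sum_{k in A} b_k / r_k phi_k of the error functional, normalised; if their
   norm vanishes then x / 0 = 0 makes them zero. *)
Lemma worst_case_error_ge A : k0 \notin A ->
  ((Num.sqrt (\sum_(k <- A) b k ^+ 2 / r k))%:E <=
   worst_case_error (cosine_space (d := d) alpha gamma)
     (cosine_norm alpha gamma) (tent_lattice_rule z))%E.
Proof.
move=> k0A; set w := \sum_(k <- A) _.
have w0 : 0 <= w by apply: sumr_ge0 => k _; rewrite divr_ge0 ?sqr_ge0// ltW.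
pose c k := b k / r k / Num.sqrt w.
have r_neq0 k : r k != 0 by rewrite gt_eqF.
have sqnormE : cosine_sqnorm alpha gamma (cosine_poly R d A c) = (w / w)%:E.
  rewrite cosine_sqnorm_poly; last by move=> k; apply/ltW/weight_gt0.
  congr EFin; rewrite mulr_suml; apply: eq_bigr => k _.
  by rewrite /c exprMn exprVn sqr_sqrtr//; move: w^-1 => v; field.
apply: ereal_sup_ubound; exists (cosine_poly R d A c).
  split.
    split.
    - exact: square_integrable_poly.
    - by rewrite sqnormE ltry.
    - exact: is_cosine_representative_poly.
  rewrite /cosine_norm sqnormE /= lee_fin -sqrtr1 ler_wsqrtr//.
  by have [->|w_neq0] := eqVneq w 0; rewrite ?mul0r// divff.
rewrite cube_integralE cosine_coef_poly (negPf k0A) tent_lattice_rule_poly//.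
rewrite sub0r normc_opp normcR; congr EFin.
have -> : \sum_(k <- A) c k * b k = w / Num.sqrt w.
  by rewrite mulr_suml; apply: eq_bigr => k _; rewrite /c; ring.
rewrite -{1}(sqr_sqrtr w0) expr2.
have [->|w_neq0] := eqVneq (Num.sqrt w) 0; first by rewrite !mul0r normr0.
by rewrite mulfK// ger0_norm// sqrtr_ge0.
Qed.

Lemma worst_case_error_sqr :
  (worst_case_error (cosine_space (d := d) alpha gamma)
     (cosine_norm alpha gamma) (tent_lattice_rule z) ^+ 2)%E = lattice_error.
Proof.
set err := worst_case_error _ _ _.
(* Nonnegativity, needed to compare squares, is the lower bound for the empty set of frequencies. *)
have err0 : (0 <= err)%E.
  have := @worst_case_error_ge fset0.
  by rewrite big_nil sqrtr0 inE; exact.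
apply/eqP; rewrite eq_le; apply/andP; split.
  rewrite -(sqr_sqrte lattice_error_ge0) lee_sqr ?sqrte_ge0//.
  by apply: ge_ereal_sup => _ [f [fC f1] <-]; exact: tent_lattice_rule_le.
(* The infinite sum is the supremum of its finite subsums, and each of these is bounded by
   [worst_case_error_ge]. *)
apply: ge_ereal_sup => _ [X [Xfin Xk0] <-].
rewrite fsbig_finite//= sumEFin.
have k0X : k0 \notin fset_set X.
  by apply/negP; rewrite in_fset_set// inE => /Xk0/=; rewrite eqxx.
have := worst_case_error_ge _ k0X; rewrite -/err.
rewrite -lee_sqr ?lee_fin ?sqrtr_ge0//; apply: le_trans.
rewrite expe2 -EFinM lee_fin -expr2 sqr_sqrtr//.
by apply: sumr_ge0 => k _; rewrite divr_ge0 ?sqr_ge0// ltW.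
Qed.

End worst_case.

(** * The error formula over the dual lattice *)

Theorem theorem2 (R : realType) (d n : nat) (alpha : R) (gamma : nat -> R)
    (z : {ffun 'I_d -> 'I_n})
    (hd : (0 < d)%N) (hn : (0 < n)%N) (halpha : 1 / 2 < alpha)
    (hgamma1 : gamma 0%N <= 1)
    (hgamma_noninc : forall j : nat, gamma j.+1 <= gamma j)
    (hgamma_pos : forall j : nat, 0 < gamma j) :
  (worst_case_error (cosine_space (d := d) alpha gamma)
     (cosine_norm alpha gamma) (tent_lattice_rule z) ^+ 2)%E =
  \esum_(k in [set k : {ffun 'I_d -> int} | k != 0 /\ dual_lattice z k])
    ((weight alpha gamma k)^-1 *
     ((2 ^+ d)^-1 *
      \sum_(sigma : {ffun 'I_d -> bool})
        (dual_lattice z (flip_signs sigma k))%:R))%:E.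
Proof.
rewrite worst_case_error_sqr//.
pose F (h : {ffun 'I_d -> int}) :=
  (weight alpha gamma h)^-1 * dual_frequency R d n z h.
have F0 h : 0 <= F h.
  by rewrite mulr_ge0 ?dual_frequency_ge0// invr_ge0 ltW// weight_gt0.
have Fs s h : F (flip_signs s h) = F h.
  by rewrite /F weight_flip dual_frequency_flip.
rewrite -[RHS]/(\esum_(h in [set h | h != 0 /\ dual_lattice z h]) (F h)%:E).
(* Averaging the membership condition produces a second factor [dual_frequency], to match the square
   of [b_k]. *)
rewrite esum_dual_lattice_average//.
rewrite (esum_absolute_values _ _ (fun h => F h * dual_frequency R d n z h));
  last 2 first.
- by move=> h; rewrite mulr_ge0// dual_frequency_ge0.
- by move=> s h; rewrite Fs dual_frequency_flip.
apply: eq_esum => k _; congr EFin.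
(* Squaring the power of [sqrt 2] in [b_k] gives exactly the number of sign choices on the support
   of [k]. *)
by rewrite /lattice_coef exprMn -exprM mulnC exprM sqr_sqrtr// /F; ring.
Qed.
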